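(* Let $G$ be a directed graph on the vertex set $[n]=\{1,\ldots,n\}$ with component size bounded by $c$, i.e. every strongly connected component of $G$ contains at most $c$ vertices, and whose edges are labeled by distinct non-commuting variables. Then there exists a non-commutative algebraic branching program of size $n^{O(c)} c^{{\sf near}(G)}$ computing the Cayley permanent of the weighted adjacency matrix of $G$.
   Context: Non-commutative polynomials are elements of the free algebra over a field $\mathbb{K}$ in non-commuting variables. An algebraic branching program (ABP) is a directed acyclic graph with two distinguished nodes $s,t$ whose edges are labeled by variables or constants; the weight of a path is the product of its edge labels in the order they occur along the path, and the ABP computes the sum of the weights of all $s\leadsto t$ paths; its size is the number of its nodes. For an $n\times n$ matrix $X=(x_{i,j})$, the Cayley permanent is ${\sf C}\mbox{-}{\sf perm}(X)=\sum_{\sigma\in S_n} x_{1,\sigma(1)}x_{2,\sigma(2)}\cdots x_{n,\sigma(n)}$ (product taken in this order). The weighted adjacency matrix of $G$ has entry $x_{i,j}$ (the label of edge $(i,j)$) if $(i,j)\in E(G)$ and $0$ otherwise. For a strongly connected component $C$ of $G$, ${\sf near}(C)=\max_{i,j\in C}|i-j|$, and ${\sf near}(G)=\max_C {\sf near}(C)$ over all strongly connected components $C$ of $G$. *)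

(* Defs.v *)
From mathcomp Require Import all_boot all_order all_fingroup all_algebra.
From mathcomp.multinomials Require Import monalg.

Set Implicit Arguments.
Unset Strict Implicit.
Unset Printing Implicit Defensive.

Import GRing.Theory.
Local Open Scope ring_scope.

(* Monomials are words over V, multiplied by concatenation. *)
Definition ncpoly (F : fieldType) (V : choiceType) := {malg F[{fmonom V}]}.

Definition ncvar (F : fieldType) (V : choiceType) (v : V) : ncpoly F V :=
  << fmu v >>.

Definition ncconst (F : fieldType) (V : choiceType) (a : F) : ncpoly F V :=
  a%:MP.

(* The entries need not commute: the product runs over the rows i = 0, 1, ...
   in increasing order. *)
Definition cayley_perm (R : nzRingType) (n : nat) (A : 'M[R]_n) : R :=
  \sum_(s : 'S_n) \prod_(i < n) A i (s i).

Definition weighted_adjacency (F : fieldType) (V : choiceType) (n : nat)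
    (E : rel 'I_n) (x : 'I_n -> 'I_n -> V) : 'M[ncpoly F V]_n :=
  \matrix_(i, j) (if E i j then ncvar F (x i j) else 0).

Definition strongly_connected (T : finType) (e : rel T) : rel T :=
  fun u v => connect e u v && connect e v u.

Definition scc (T : finType) (e : rel T) : {set {set T}} :=
  equivalence_partition (strongly_connected e) [set: T].

(* `|i - j| is the distance between the natural numbers i and j (ssrint), not
   the truncated difference. *)
Definition near_set (n : nat) (C : {set 'I_n}) : nat :=
  (\max_(i in C) \max_(j in C) `|i - j|)%N.

Definition near (n : nat) (E : rel 'I_n) : nat :=
  (\max_(C in scc E) near_set C)%N.

Definition acyclic (T : finType) (e : rel T) : Prop :=
  forall u v, e u v -> ~~ connect e v u.

Variant abp_label (F : fieldType) (V : choiceType) :=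
  | LVar of V
  | LConst of F.

Definition label_poly (F : fieldType) (V : choiceType) (l : abp_label F V) :
    ncpoly F V :=
  match l with LVar v => ncvar F v | LConst a => ncconst V a end.

(* The values of abp_lab outside of abp_edge are irrelevant. *)
Record abp (F : fieldType) (V : choiceType) := ABP {
  abp_node : finType;
  abp_edge : rel abp_node;
  abp_acyclic : acyclic abp_edge;
  abp_src : abp_node;
  abp_snk : abp_node;
  abp_src_snk : abp_src != abp_snk;
  abp_lab : abp_node -> abp_node -> abp_label F V
}.

Definition abp_size (F : fieldType) (V : choiceType) (B : abp F V) : nat :=
  #|abp_node B|.

(* The weight of the walk u :: p, i.e. the ordered product of the labels of its
   size p edges. *)
Fixpoint walk_weight (F : fieldType) (V : choiceType) (B : abp F V)
    (u : abp_node B) (p : seq (abp_node B)) : ncpoly F V :=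
  if p is v :: q then label_poly (abp_lab u v) * walk_weight v q else 1.

(* The sum of the weights of all paths from source to sink, grouped by number
   of edges k. By acyclic_path_size below, the bound on k omits no path. *)
Definition abp_poly (F : fieldType) (V : choiceType) (B : abp F V) :
    ncpoly F V :=
  \sum_(k < #|abp_node B|)
    \sum_(p : k.-tuple (abp_node B) |
            path (@abp_edge F V B) (abp_src B) p
            && (last (abp_src B) p == abp_snk B))
      walk_weight (abp_src B) p.

Lemma acyclic_path_uniq (T : finType) (e : rel T) (u : T) (p : seq T) :
  acyclic e -> path e u p -> uniq (u :: p).
Proof.
move=> ace; elim: p u => [//|v p IHp] u /= /andP[euv evp].
rewrite -[(v \notin p) && _]/(uniq (v :: p)) IHp // andbT.
apply/negP=> u_vp; have := ace _ _ euv; apply/negP; rewrite negbK.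
case/splitPl: u_vp evp => p1 p2 last_p1; rewrite cat_path => /andP[evp1 _].
by apply/connectP; exists p1.
Qed.

Lemma acyclic_path_size (T : finType) (e : rel T) (u : T) (p : seq T) :
  acyclic e -> path e u p -> (size p < #|T|)%N.
Proof.
by move=> ace /(acyclic_path_uniq ace) /card_uniqP /= <-; apply: max_card.
Qed.

(* Main.v *)
Require Import Defs.
From mathcomp Require Import all_boot all_order all_fingroup all_algebra.
From mathcomp.multinomials Require Import monalg.

(** Expand the permanent row by row, remembering only the set of columns used
    so far: after the rows below [i], a cycle cover [s] is at the state
    [s @: [0, i)]. Since [s] maps every strongly connected component to itself,
    components lying entirely below [i] are used up, and every other component
    that meets [0, i) does so within [i - near, i). Hence the state is
    determined by the values of [s] on these [near] rows, each of which is one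
    of the at most [c] vertices of the component of the row. This leaves
    [c ^ near] states per layer. *)

Set Implicit Arguments.
Unset Strict Implicit.
Unset Printing Implicit Defensive.

Import GRing.Theory.
Local Open Scope ring_scope.

Lemma walk_weightE (F : fieldType) (V : choiceType) (B : abp F V)
    (u w : abp_node B) (p : seq (abp_node B)) :
  walk_weight u p =
  \prod_(i < size p) label_poly (abp_lab (nth w (u :: p) i) (nth w p i)).
Proof.
elim: p u => [|v p IHp] u /=; first by rewrite big_ord0.
by rewrite big_ord_recl IHp.
Qed.

(** * Images of initial segments of rows *)

Section Prefix.
Variable n : nat.
Implicit Types (f : 'I_n -> 'I_n) (s : 'S_n).

Definition prefix_image f (i : nat) : {set 'I_n} :=
  f @: [set r : 'I_n | (r < i)%N].

Lemma prefix_image0 f : prefix_image f 0 = set0.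
Proof.
by apply/setP=> j; rewrite inE; apply/imsetP=> -[r]; rewrite inE.
Qed.

Lemma prefix_imageS f (i : 'I_n) :
  prefix_image f i.+1 = f i |: prefix_image f i.
Proof.
rewrite /prefix_image -imsetU1; congr (_ @: mem (_ : {set _})).
by apply/setP=> r; rewrite !inE ltnS leq_eqVlt.
Qed.

Lemma mem_prefix_image s i r : (s r \in prefix_image s i) = (r < i)%N.
Proof. by rewrite mem_imset ?inE //; exact: perm_inj. Qed.

Lemma prefix_imageT s : prefix_image s n = setT.
Proof. by apply/setP=> j; rewrite -[j](permKV s) mem_prefix_image inE ltn_ord. Qed.

End Prefix.

(** * The layered program on an arbitrary family of states *)

Section ColumnSetABP.
Variables (F : fieldType) (V : choiceType) (n : nat).
Variables (E : rel 'I_n) (x : 'I_n -> 'I_n -> V).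
Variable states : {set 'I_n.+1 * {set 'I_n}}.

Definition cycle_cover (s : 'S_n) := [forall r, E r (s r)].

Hypothesis n_gt0 : (0 < n)%N.
(** The identity need not be a cycle cover. Its states provide a source and a sink even when [E] has
    no cycle cover at all. *)
Hypothesis states1 : forall i : 'I_n.+1, (i, prefix_image (1%g : 'S_n) i) \in states.
Hypothesis states_cover : forall s (i : 'I_n.+1),
  cycle_cover s -> (i, prefix_image s i) \in states.

Definition state := {u | u \in states}.

Definition level (u : state) : 'I_n.+1 := (val u).1.
Definition used (u : state) : {set 'I_n} := (val u).2.

Definition step (u v : state) (ij : 'I_n * 'I_n) :=
  [&& level u == ij.1 :> nat, level v == ij.1.+1 :> nat, E ij.1 ij.2,
      ij.2 \notin used u & used v == ij.2 |: used u].

Definition state_edge : rel state := fun u v => [exists ij, step u v ij].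

Definition state_label (u v : state) : abp_label F V :=
  if [pick ij | step u v ij] is Some ij then LVar F (x ij.1 ij.2)
  else LConst V 0.

(** The row is the level of [u], and the column is the only element of [used v] outside [used u], so
    [pick] has no choice. *)
Lemma state_labelE u v ij :
  step u v ij -> state_label u v = LVar F (x ij.1 ij.2).
Proof.
rewrite /state_label; case: pickP => [[i' j'] /= | /(_ ij) -> //].
case: ij => i j /and5P[/= /eqP ui' _ _ j'u /eqP vj'].
case/and5P=> /= /eqP ui _ _ ju /eqP vj.
have -> : i' = i by apply: val_inj; rewrite /= -ui -ui'.
have : j' \in j |: used u by rewrite -vj vj' !inE eqxx.
by rewrite !inE (negPf j'u) orbF => /eqP->.
Qed.

Lemma level_edge u v : state_edge u v -> level v = (level u).+1 :> nat.
Proof. by case/existsP=> ij /and5P[/eqP-> /eqP->]. Qed.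

Lemma level_path u p :
  path state_edge u p -> level (last u p) = (level u + size p)%N :> nat.
Proof.
elim: p u => [|v p IHp] u /=; first by rewrite addn0.
by case/andP=> /level_edge uv /IHp->; rewrite uv addSnnS.
Qed.

Lemma state_acyclic : acyclic state_edge.
Proof.
move=> u v /level_edge uv; apply/negP=> /connectP[p /level_path + uE].
by rewrite -uE uv => /eqP; rewrite addSn -addnS -{1}[level u : nat]addn0 eqn_add2l.
Qed.

Definition source : state := Sub (ord0, prefix_image (1%g : 'S_n) ord0) (states1 ord0).
Definition sink : state := Sub (ord_max, prefix_image (1%g : 'S_n) ord_max) (states1 ord_max).

Lemma source_neq_sink : source != sink.
Proof.
apply/negP=> /eqP/(congr1 level)/(congr1 val)/= n0.
by have := n_gt0; rewrite -[X in (_ < X)%N]n0.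
Qed.

Definition column_set_abp : abp F V :=
  @ABP F V state state_edge state_acyclic source sink source_neq_sink state_label.

(** The default [source] is never taken when [s] is a cycle cover and [i <= n]. *)
Definition cover_state (s : 'S_n) (i : nat) : state :=
  insubd source (inord i, prefix_image s i).

Lemma val_cover_state (s : 'S_n) i :
    (forall i : 'I_n.+1, (i, prefix_image s i) \in states) -> (i <= n)%N ->
  val (cover_state s i) = (inord i, prefix_image s i).
Proof.
by move=> sS le_in; rewrite val_insubd -{2}(@inordK n i le_in) sS.
Qed.

Definition cover_path (s : 'S_n) : n.-tuple state :=
  [tuple cover_state s i.+1 | i < n].

Lemma nth_cover_path s w (i : 'I_n) :
  nth w (cover_path s) i = cover_state s i.+1.
Proof. by rewrite -tnth_nth tnth_mktuple. Qed.

Lemma cover_state0 s : cycle_cover s -> cover_state s 0 = source.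
Proof.
move=> sE; apply: val_inj; rewrite val_cover_state //=; last first.
  by move=> i; apply: states_cover.
rewrite !prefix_image0; congr (_, _); exact/val_inj/inordK.
Qed.

Lemma cover_staten s : cycle_cover s -> cover_state s n = sink.
Proof.
move=> sE; apply: val_inj; rewrite val_cover_state //=; last first.
  by move=> i; apply: states_cover.
rewrite !prefix_imageT; congr (_, _); exact/val_inj/inordK.
Qed.

Lemma nth_cons_cover_path s w (i : 'I_n) : cycle_cover s ->
  nth w (source :: cover_path s) i = cover_state s i.
Proof.
move=> sE; case: i => -[|i] lt_in; first by rewrite /= cover_state0.
exact: (nth_cover_path s w (Ordinal (ltnW lt_in))).
Qed.

Lemma step_cover s (i : 'I_n) : cycle_cover s ->
  step (cover_state s i) (cover_state s i.+1) (i, s i).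
Proof.
move=> sE; have sS i' := @states_cover s i' sE.
rewrite /step /level /used !val_cover_state ?ltn_ord // 1?ltnW ?ltn_ord //=.
rewrite !inordK ?ltnS ?ltn_ord // 1?ltnW ?ltn_ord // !eqxx (forallP sE) /=.
by rewrite mem_prefix_image ltnn prefix_imageS eqxx.
Qed.

Definition full_paths (k : nat) : {set k.-tuple state} :=
  [set p : k.-tuple state | path state_edge source p & last source p == sink].

Lemma cover_path_full s : cycle_cover s -> cover_path s \in full_paths n.
Proof.
move=> sE; rewrite inE; apply/andP; split.
  apply/(pathP source) => i; rewrite size_tuple => lt_in.
  rewrite (nth_cons_cover_path _ (Ordinal lt_in)) //.
  rewrite (nth_cover_path _ _ (Ordinal lt_in)).
  by apply/existsP; exists (Ordinal lt_in, s (Ordinal lt_in)); apply: step_cover.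
rewrite -nth_last size_tuple.
have lt_n1 : (n.-1 < n)%N by rewrite prednK.
by rewrite (nth_cover_path _ _ (Ordinal lt_n1)) /= prednK // cover_staten.
Qed.

(** The levels force the edge number [i] to choose a column [f i] for row [i]. Each chosen column is
    new, so [f] is injective, and the states on the path are its prefix images. *)
Lemma full_path_cover (p : n.-tuple state) : p \in full_paths n ->
  exists2 s, cycle_cover s & p = cover_path s.
Proof.
rewrite inE => /andP[/(pathP source) pE _].
pose u i := nth source (source :: p) i.
have [f fP] : exists f : {ffun 'I_n -> 'I_n},
      forall i : 'I_n, step (u i) (u i.+1) (i, f i).
  have /fin_all_exists[f fP] (i : 'I_n) : exists j, step (u i) (u i.+1) (i, j).
    have lev k : (k <= n)%N -> level (u k) = k :> nat.
      elim: k => //= k IHk lt_kn; rewrite -[in RHS](IHk (ltnW lt_kn)).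
      by apply: level_edge; apply: pE; rewrite size_tuple.
    have /existsP[[i' j] st] : state_edge (u i) (u i.+1).
      by apply: pE; rewrite size_tuple.
    exists j; suff ii' : i = i' by rewrite -ii' in st.
    have /and5P[/eqP + _ _ _ _] := st.
    by rewrite (lev _ (ltnW (ltn_ord i))) => /val_inj.
  by exists (finfun f) => i; rewrite ffunE.
have usedE k : (k <= n)%N -> used (u k) = prefix_image f k.
  elim: k => [_|k IHk lt_kn]; first by rewrite /used /= !prefix_image0.
  have /and5P[_ _ _ _ /eqP->] := fP (Ordinal lt_kn).
  by rewrite IHk 1?ltnW // (prefix_imageS f (Ordinal lt_kn)).
(* At step [j], the column of an earlier row [i] is already used, while [f j] is not. *)
have f_neq (i j : 'I_n) : (i < j)%N -> f i <> f j.
  move=> lt_ij fij; have /and5P[_ _ _ /= + _] := fP j.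
  by rewrite usedE 1?ltnW // -fij imset_f ?inE.
have f_inj : injective f.
  move=> i j fij; apply: val_inj.
  by case: (ltngtP i j) => // [/f_neq/(_ fij) | /f_neq/(_ (esym fij))].
have sE : cycle_cover (perm f_inj).
  by apply/forallP=> i; rewrite permE; have /and5P[] := fP i.
exists (perm f_inj) => //; apply: eq_from_tnth => i; rewrite tnth_mktuple (tnth_nth source).
apply: val_inj; rewrite val_cover_state //; last by move=> i'; apply: states_cover.
rewrite [LHS]surjective_pairing; congr (_, _).
  apply: val_inj; rewrite /= inordK ?ltnS //.
  by have /and5P[_ /eqP + _ _ _] := fP i.
by rewrite [LHS](usedE i.+1) //; apply: eq_imset => r; rewrite permE.
Qed.

Lemma full_paths_cover : full_paths n = [set cover_path s | s in cycle_cover].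
Proof.
apply/setP=> p; apply/idP/imsetP=> [/full_path_cover[s sE ->] | [s sE ->]].
  by exists s.
exact: cover_path_full.
Qed.

(** The column [s i] is recovered from the path as the one that step [i] adds. *)
Lemma cover_path_inj : {in cycle_cover &, injective cover_path}.
Proof.
move=> s t sE tE st; apply/permP=> i.
have stepst : step (cover_state s i) (cover_state s i.+1) (i, t i).
  rewrite -(nth_cons_cover_path source i sE) -(nth_cover_path s source) st.
  by rewrite nth_cons_cover_path // nth_cover_path step_cover.
have /and5P[_ _ _ _ /eqP/= su] := step_cover i sE.
have /and5P[_ _ _ tu /eqP/= tv] := stepst.
have : t i \in s i |: used (cover_state s i) by rewrite -su tv setU11.
by rewrite !inE (negPf tu) orbF => /eqP.
Qed.

(** There is a node on each of the [n.+1] levels. Hence the length [n] lies in the range of the sum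
    in [abp_poly]. *)
Lemma card_state_gt : (n < #|{: state}|)%N.
Proof.
pose h (i : 'I_n.+1) : state := Sub (i, _) (states1 i).
rewrite -[X in (X <= _)%N]card_ord; apply: (leq_card h) => i j.
by move/(congr1 level).
Qed.

(** Paths from source to sink correspond bijectively to cycle covers, and each path reads its
    variables in the order of the rows. *)
Lemma column_set_abp_poly :
  abp_poly column_set_abp = cayley_perm (weighted_adjacency F E x).
Proof.
have adjE (s : 'S_n) : \prod_(i < n) weighted_adjacency F E x i (s i) =
    if cycle_cover s then \prod_(i < n) ncvar F (x i (s i)) else 0.
  case: ifPn => [/forallP sE | /forallPn[i /negPf sEi]].
    by apply: eq_bigr => i _; rewrite mxE sE.
  (* The factors do not commute, so the product is split around its zero factor. *)
  case/path.splitPr: (mem_index_enum i) => p1 p2.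
  by rewrite big_cat big_cons /= mxE sEi mul0r mulr0.
rewrite /abp_poly /cayley_perm (bigD1 (Ordinal card_state_gt)) //=.
(* The sink has level [n], so no path of another length reaches it. *)
rewrite [X in _ + X]big1 ?addr0 => [|k /eqP kn]; last first.
  apply: big_pred0 => p; apply/negP=> /andP[/level_path + /eqP pl].
  rewrite pl /= add0n size_tuple => nk.
  by apply: kn; apply: val_inj.
under [RHS]eq_bigr do rewrite adjE.
rewrite -big_mkcond /= (eq_bigl [in full_paths n]) => [|p]; last by rewrite inE.
rewrite full_paths_cover big_imset; last exact: cover_path_inj.
apply: eq_bigr => s sE /=.
rewrite (walk_weightE _ (source : abp_node column_set_abp)) /= size_map size_enum_ord.
apply: eq_bigr => i _.
rewrite nth_cons_cover_path // nth_cover_path.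
by rewrite (state_labelE (step_cover i sE)).
Qed.

End ColumnSetABP.

(** * Strongly connected components and the coding of states *)

Section Components.
Variables (n : nat) (E : rel 'I_n).

Definition component (r : 'I_n) : {set 'I_n} :=
  [set q | strongly_connected E r q].

Lemma component_scc r : component r \in scc E.
Proof.
by apply/imsetP; exists r => //; apply/setP=> q; rewrite !inE.
Qed.

Lemma component_refl r : r \in component r.
Proof. by rewrite inE /strongly_connected connect0. Qed.

Lemma component_eq q r : q \in component r -> component q = component r.
Proof.
rewrite inE => /andP[rq qr]; apply/setP=> t; rewrite !inE.
apply/andP/andP=> -[a b]; split; by [apply: connect_trans rq a |
  apply: connect_trans b qr | apply: connect_trans qr a | apply: connect_trans b rq].
Qed.

Lemma component_near r q : q \in component r -> (q <= r + near E)%N.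
Proof.
move=> qr; rewrite -leq_subLR; apply: leq_trans (_ : `|q - r| <= _)%N.
  by case: (leqP r q) => [/distnEl-> // | /ltnW]; rewrite -subn_eq0 => /eqP->.
rewrite /near (leq_trans _ (leq_bigmax_cond _ (component_scc r))) //.
rewrite /near_set (leq_trans _ (leq_bigmax_cond _ qr)) //.
exact: (@leq_bigmax_cond _ [in component r] (fun j => `|q - j|%N) r
  (component_refl r)).
Qed.

(** The cycle of [s] through [r] is a closed walk in [E]. *)
Lemma cycle_cover_component (s : 'S_n) r :
  cycle_cover E s -> s r \in component r.
Proof.
move=> /forallP sE; rewrite inE /strongly_connected connect1 //=.
have: fconnect s (s r) r by rewrite fconnect_sym ?fconnect1 //; exact: perm_inj.
apply: connect_sub => a b /eqP <-; exact: connect1.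
Qed.

(** The [k]-th code entry is the position of the image of row [i - 1 - k] in the
    component of that row. *)
Definition decode (c i : nat) (g : {ffun 'I_(near E) -> 'I_c}) : {set 'I_n} :=
  [set j | [forall q in component j, (q < i)%N] ||
    [exists k : 'I_(near E), [exists r : 'I_n,
      ((r + k).+1 == i) && (j == nth r (enum (component r)) (g k))]]].

(** Preserving the components is all that is asked of [s], so that the identity is covered along
    with the cycle covers. *)
Lemma prefix_image_decode (c : nat) (s : 'S_n) i :
    (forall r, s r \in component r) -> (forall r, #|component r| <= c)%N ->
    (0 < c)%N ->
  exists g : {ffun 'I_(near E) -> 'I_c}, prefix_image s i = decode i g.
Proof.
case: c => // c' sC leC _.
have sCe r : component (s r) = component r by apply: component_eq.
have nthK (r : 'I_n) :
    nth r (enum (component r)) (inord (index (s r) (enum (component r))) : 'I_c'.+1)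
      = s r.
  rewrite inordK ?nth_index ?mem_enum //.
  by rewrite (leq_trans _ (leC r)) // cardE index_mem mem_enum.
(* The entry [ord0] stands where row [i - 1 - k] does not exist; [decode] ignores such entries. *)
pose g : {ffun 'I_(near E) -> 'I_c'.+1} := [ffun k : 'I_(near E) =>
  if [pick r : 'I_n | (r + k).+1 == i] is Some r
  then inord (index (s r) (enum (component r))) else ord0].
have gE (k : 'I_(near E)) (r : 'I_n) : (r + k).+1 = i ->
    nth r (enum (component r)) (g k) = s r.
  rewrite ffunE => rk; case: pickP => [r' | /(_ r)]; last by rewrite rk eqxx.
  by rewrite -rk eqSS eqn_add2r => /eqP/val_inj->.
exists g; apply/setP=> j; rewrite -[j](permKV s) mem_prefix_image inE.
move: ((s^-1)%g j) => r; apply/idP/orP.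
  (* If [r + near E < i], the whole component of [r] lies below [i]; otherwise [r] is one of the
     [near E] rows just before [i] and has a code entry. *)
  move=> lt_ri; case: (leqP i (r + near E)) => [le_i | lt_i]; [right | left].
    have lt_k : (i - r.+1 < near E)%N.
      by rewrite ltn_subLR // addSn ltnS.
    apply/existsP; exists (Ordinal lt_k); apply/existsP; exists r.
    have rk : (r + (i - r.+1)).+1 = i by rewrite -addSn subnKC.
    by rewrite (gE (Ordinal lt_k)) /= rk ?eqxx.
  apply/forall_inP=> q; rewrite sCe => /component_near qr.
  exact: leq_ltn_trans qr lt_i.
case=> [/forall_inP | /existsP[k /existsP[r' /andP[/eqP rk]]]].
  by apply; rewrite sCe component_refl.
by rewrite (gE _ _ rk) => /eqP/perm_inj->; rewrite -rk ltnS leq_addr.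
Qed.

End Components.

Theorem theorem1 :
  exists K : nat,
  forall (F : fieldType) (V : choiceType) (n c : nat)
         (E : rel 'I_n) (x : 'I_n -> 'I_n -> V),
    (0 < n)%N ->
    (forall C : {set 'I_n}, C \in scc E -> (#|C| <= c)%N) ->
    (forall i j i' j' : 'I_n,
        E i j -> E i' j' -> x i j = x i' j' -> i = i' /\ j = j') ->
    exists B : abp F V,
      abp_poly B = cayley_perm (weighted_adjacency F E x) /\
      (abp_size B <= maxn 2 n ^ (K * c) * c ^ near E)%N.
Proof.
(* There are at most [n.+1 * c ^ near E] states, and [n.+1 <= 2 * maxn 2 n <= maxn 2 n ^ 2]. The
   exponent [2] is at most [2 * c] since components are nonempty. *)
exists 2 => F V n c E x n_gt0 scc_le _.
have leC r : (#|component E r| <= c)%N by apply/scc_le/component_scc.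
have c_gt0 : (0 < c)%N.
  apply: leq_trans (leC (Ordinal n_gt0)); apply/card_gt0P.
  by exists (Ordinal n_gt0); apply: component_refl.
pose code (ig : 'I_n.+1 * {ffun 'I_(near E) -> 'I_c}) := (ig.1, decode ig.1 ig.2).
(* As an image of the codes, [states] is bounded by their number. Decoded sets that are no prefix
   image do no harm: every full path still comes from a cycle cover. *)
pose states := [set code ig | ig in setT].
have statesP (s : 'S_n) (i : 'I_n.+1) : (forall r, s r \in component E r) ->
    (i, prefix_image s i) \in states.
  move=> sC; have [g ->] := prefix_image_decode i sC leC c_gt0.
  exact: (imset_f code (in_setT (i, g))).
have states1 (i : 'I_n.+1) : (i, prefix_image (1%g : 'S_n) i) \in states.
  by apply: statesP => r; rewrite perm1 component_refl.
have states_cover (s : 'S_n) (i : 'I_n.+1) :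
    cycle_cover E s -> (i, prefix_image s i) \in states.
  by move=> sE; apply: statesP => r; apply: cycle_cover_component.
exists (column_set_abp F E x n_gt0 states1); split.
  exact: column_set_abp_poly.
rewrite /abp_size /= card_sig (leq_trans (leq_imset_card _ _)) //.
rewrite cardsT card_prod card_ffun !card_ord leq_mul2r; apply/orP; right.
apply: (@leq_trans (maxn 2 n ^ 2)); last first.
  by rewrite leq_pexp2l ?leq_pmulr // (leq_trans _ (leq_maxl 2 n)).
rewrite expnS expn1 (leq_trans (_ : _ <= 2 * maxn 2 n)%N) //; last first.
  by rewrite leq_mul2r leq_maxl orbT.
by rewrite mul2n -addnn -addn1 addnC leq_add // leq_max ?leqnn ?orbT.
Qed.
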